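(* Let $\Phi(L,W,S,B)$ with $L\le c_1$, $2\le W\le c_2N$, $S\le c_2N$, $1\le B\le c_2N$ for constants $c_1,c_2$ and $N$ sufficiently large, and let $\nabla\Phi(L,W,S,B)=\{x\mapsto\|\nabla F(x)\|:F\in\Phi(L,W,S,B)\}$. Then there is a constant $C$ depending only on $d,c_1$ such that for all $\delta\in(0,1)$ $$\log\mathcal N\big(\delta,\nabla\Phi(L,W,S,B),\|\cdot\|_\infty\big)\le C\,S\big[\log(\delta^{-1})+3^L\log(WB)\big],$$ where $\|g\|_\infty=\sup_{x\in\Omega}|g(x)|$.
   Context: $\Omega=[0,1]^d$. For integers $L,W,S\ge1$ and $B>0$, $\Phi(L,W,S,B)$ is the set of functions $F:\mathbb R^d\to\mathbb R$ of the form $F=(\mathcal W^{(L)}\eta_3(\cdot)+b^{(L)})\circ\cdots\circ(\mathcal W^{(2)}\eta_3(\cdot)+b^{(2)})\circ(\mathcal W^{(1)}x+b^{(1)})$, where $\eta_3(t)=\max\{t,0\}^3$ acts componentwise, $\mathcal W^{(1)}\in\mathbb R^{W\times d}$, $b^{(1)}\in\mathbb R^W$, $\mathcal W^{(l)}\in\mathbb R^{W\times W}$, $b^{(l)}\in\mathbb R^W$ for $1<l<L$, $\mathcal W^{(L)}\in\mathbb R^{1\times W}$, $b^{(L)}\in\mathbb R$, the total number of nonzero entries of all $\mathcal W^{(l)},b^{(l)}$ is at most $S$, and all entries have absolute value at most $B$. $\|\nabla F(x)\|$ is the Euclidean norm of the gradient. $\mathcal N(\delta,A,\|\cdot\|)$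 is the minimal number of $\|\cdot\|$-balls of radius $\delta$ centered in $A$ needed to cover $A$. *)

(* Defs.v *)
From HB Require Import structures.
From mathcomp Require Import all_boot all_order all_algebra.
From mathcomp Require Import all_classical all_reals all_analysis.
Set Implicit Arguments. Unset Strict Implicit. Unset Printing Implicit Defensive.
Import Order.TTheory GRing.Theory Num.Theory.
Import numFieldNormedType.Exports.
Local Open Scope classical_set_scope.
Local Open Scope ring_scope.

Section Defs.
Variable R : realType.

Definition eta3 (t : R) : R := (Num.max t 0) ^+ 3.

Definition act {n : nat} (v : 'cV[R]_n) : 'cV[R]_n := map_mx eta3 v.

Definition nnz {m n : nat} (A : 'M[R]_(m, n)) : nat :=
  \sum_(i < m) \sum_(j < n) (A i j != 0%R : nat).

Definition entries_le {m n : nat} (A : 'M[R]_(m, n)) (B : R) : Prop :=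
  forall i j, `|A i j| <= B.

(* Network with L >= 2 layers, input x : 'rV_d (as a point of R^d):
   W1 : W x d, b1, hidden layers ms (L-2 pairs of W x W matrix and bias),
   output row WL : 1 x W and scalar bias bL. *)
Definition net {d W : nat} (W1 : 'M[R]_(W, d)) (b1 : 'cV[R]_W)
  (ms : seq ('M[R]_W * 'cV[R]_W)) (WL : 'M[R]_(1, W)) (bL : R)
  (x : 'rV[R]_d) : R :=
  (WL *m act (foldl (fun v p => p.1 *m act v + p.2) (W1 *m x^T + b1) ms)) 0 0
  + bL.

(* Phi(L,W,S,B). For L = 1 the composition reduces to the affine map
   x |-> W^(1) x + b^(1) with W^(1) in R^(1 x d), b^(1) in R. *)
Definition Phi (d : nat) (L W S : nat) (B : R) : set ('rV[R]_d -> R) :=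
  [set F | (L = 1%N /\
       exists (w : 'M[R]_(1, d)) (b : R),
         (nnz w + (b != 0%R : nat) <= S)%N /\ entries_le w B /\ `|b| <= B /\
         F = fun x => (w *m x^T) 0 0 + b)
   \/ ((2 <= L)%N /\
       exists (W1 : 'M[R]_(W, d)) (b1 : 'cV[R]_W)
              (ms : seq ('M[R]_W * 'cV[R]_W)) (WL : 'M[R]_(1, W)) (bL : R),
         size ms = (L - 2)%N /\
         (nnz W1 + nnz b1 + \sum_(p <- ms) (nnz p.1 + nnz p.2)
            + nnz WL + (bL != 0%R : nat) <= S)%N /\
         entries_le W1 B /\ entries_le b1 B /\
         (forall p, p \in ms -> entries_le p.1 B /\ entries_le p.2 B) /\
         entries_le WL B /\ `|bL| <= B /\
         F = net W1 b1 ms WL bL)].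

Definition gradnorm {d : nat} (F : 'rV[R]_d -> R) (x : 'rV[R]_d) : R :=
  Num.sqrt (\sum_(i < d) ('D_(delta_mx 0 i) F x) ^+ 2).

Definition gradPhi (d : nat) (L W S : nat) (B : R) : set ('rV[R]_d -> R) :=
  [set g | exists F, @Phi d L W S B F /\ g = gradnorm F].

Definition Omega (d : nat) : set ('rV[R]_d) :=
  [set x | forall i, 0 <= x 0 i <= 1].

Definition covers {d : nat} (delta : R) (A : set ('rV[R]_d -> R)) (n : nat) :=
  exists c : 'I_n -> ('rV[R]_d -> R),
    (forall i, A (c i)) /\
    forall g, A g -> exists i, forall x, @Omega d x -> `|g x - c i x| <= delta.

(* covering number N(delta, A, ||.||_infty) in \bar R (+oo if no finite cover) *)
Definition covering_number {d : nat} (delta : R) (A : set ('rV[R]_d -> R))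
  : \bar R :=
  ereal_inf [set (n%:R)%:E | n in [set n | covers delta A n]].

End Defs.
Arguments Phi {R} d L W S B _.
Arguments gradPhi {R} d L W S B _.

(* Main.v *)
Require Import Defs.
From HB Require Import structures.
From mathcomp Require Import all_boot all_order all_algebra.
From mathcomp Require Import all_classical all_reals all_analysis.
From mathcomp Require Import ring lra zify.
Import Order.TTheory GRing.Theory Num.Theory.
Import numFieldNormedType.Exports.
Local Open Scope classical_set_scope.
Local Open Scope ring_scope.

(* Each hidden layer maps a jet (value, directional derivative) to a jet. If the
   entries of both components are bounded by T >= 1 and are (e T)-close for two
   networks whose weights are e-close, then after one more layer the same holds
   with Q T^3 in place of T, where Q is a multiple of W B; hence after L layers
   the partial derivatives of the two networks differ by at most e Q^(3^L - 1).
   Rounding the at most S nonzero weights to a grid of width delta / Q^(3^L),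
   and recording their positions among O(W^2) entries, leaves at most
   (delta^-1 Q^(2 3^L))^S classes, each of diameter at most delta; choosing one
   member of each class gives a cover centered in the family. *)

(** * Derivatives of the activation and of networks along a line *)

(** Both difference quotients are the same function of the increment, so directional derivatives
    reduce to derivatives in one real variable. *)
Lemma is_derive_line {R : realType} (V : normedModType R) (F : V -> R) (x v : V) (l : R) :
  is_derive (0 : R) 1 (fun t : R => F (t *: v + x)) l -> is_derive x v F l.
Proof.
move=> [D E].
suff eq : (fun h : R => h^-1 *: (((fun t : R => F (t *: v + x)) \o shift (0 : R)) (h *: (1 : R)) -
            F ((0 : R) *: v + x))) = (fun h : R => h^-1 *: ((F \o shift x) (h *: v) - F x)).
  split; first by move: D; rewrite /derivable eq.
  by move: E; rewrite /derive eq.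
apply/funext => h; rewrite /= scale0r add0r.
by congr (_ *: (F (_ *: v + x) - _)); rewrite addr0; apply: mulr1.
Qed.

(** A quadratic remainder valid across the kink at 0. On the positive side it is exactly
    [(3 * x + h) * h ^+ 2]; if [x] and [x + h] lie on opposite sides of 0, both are at most |h| in
    absolute value. *)
Lemma eta3_taylor {R : realType} (x h : R) : `|h| <= 1 ->
  `|eta3 (x + h) - eta3 x - 3 * Num.max x 0 ^+ 2 * h| <= (4 * Num.max x 0 + 1) * h ^+ 2.
Proof.
rewrite /eta3 => h1.
have h2 : `|h| ^+ 2 = h ^+ 2 by rewrite real_normK ?num_real.
have h0 := normr_ge0 h.
have [x0|x0] := leP 0 x; have [y0|y0] := leP 0 (x + h).
- rewrite (_ : _ - _ = (3 * x + h) * h ^+ 2); last by ring.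
  rewrite normrM [X in _ * X]ger0_norm ?sqr_ge0//.
  rewrite ler_wpM2r ?sqr_ge0// (le_trans (ler_normD _ _))//.
  rewrite ger0_norm; nra.
- rewrite !expr0n/= sub0r.
  have h00 : h < 0 by lra.
  have H : x ^+ 2 <= h ^+ 2 by nra.
  have H3 := ler_wpM2l x0 H.
  have H4 : x * (x * (- h)) <= x * (h * h) by apply: ler_wpM2l => //; nra.
  have H5 : 0 <= h ^+ 2 by apply: sqr_ge0.
  have H6 : 0 <= x ^+ 3 by apply: exprn_ge0.
  have H7 : 0 <= x * (x * - h) by rewrite !mulr_ge0//; lra.
  rewrite ler_norml; apply/andP; split; nra.
- rewrite !expr0n/= !(mulr0, mul0r) !subr0 add0r mul1r.
  rewrite ger0_norm ?exprn_ge0//.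
  have hh : 0 < h by lra.
  move: h1; rewrite gtr0_norm// => h1.
  have : (x + h) ^+ 2 <= h ^+ 2 by nra.
  have : (x + h) ^+ 3 <= (x + h) ^+ 2 by apply: ler_wiXn2l => //; lra.
  lra.
- by rewrite !expr0n/= ?(mulr0, mul0r, subr0, subrr) normr0 mulr_ge0 ?sqr_ge0//; lra.
Qed.

(** The remainder bound, divided by |h|, squeezes the difference quotient between [l - K * |h|] and
    [l + K * |h|]. *)
Lemma is_derive_eta3 {R : realType} (x : R) :
  is_derive x 1 (@eta3 R) (3 * Num.max x 0 ^+ 2).
Proof.
set l := (X in is_derive _ _ _ X).
suff H : h^-1 *: ((@eta3 R \o shift x) (h *: (1 : R)) - eta3 x) @[h --> (0:R)^'] --> l.
  by split; [apply/cvg_ex; exists l | apply: cvg_lim].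
pose K : R := 4 * Num.max x 0 + 1.
have K0 : 0 <= K by rewrite /K addr_ge0// mulr_ge0// le_max lexx orbT.
have A : l - K * `|h| @[h --> (0:R)^'] --> l.
  rewrite -[X in _ --> X]subr0 -[in X in _ --> X](mulr0 K).
  apply: cvgB; first exact: cvg_cst.
  apply: cvgMr; rewrite -[X in _ --> X](@normr0 _ R).
  by apply: cvg_norm; apply: nbhs_dnbhs.
have B : l + K * `|h| @[h --> (0:R)^'] --> l.
  rewrite -[X in _ --> X]addr0 -[in X in _ --> X](mulr0 K).
  apply: cvgD; first exact: cvg_cst.
  apply: cvgMr; rewrite -[X in _ --> X](@normr0 _ R).
  by apply: cvg_norm; apply: nbhs_dnbhs.
apply: (squeeze_cvgr _ A B).
near=> h.
have h0 : h != 0 by near: h; exact: nbhs_dnbhs_neq.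
have h1 : `|h| <= 1.
  near: h; apply: nbhs_dnbhs.
  by apply/nbhs_ballP; exists 1 => //= y; rewrite /ball/= sub0r normrN => /ltW.
rewrite -ler_distl /=.
have -> : h *: (1 : R) + x = x + h by rewrite addrC; congr (_ + _); apply: mulr1.
have -> : h^-1 *: (eta3 (x + h) - eta3 x) - l = h^-1 * (eta3 (x + h) - eta3 x - l * h).
  by rewrite /GRing.scale/=; field.
rewrite normrM normfV ler_pdivrMl ?normr_gt0//.
apply: (le_trans (eta3_taylor _ _ h1)).
have -> : `|h| * (K * `|h|) = K * `|h| ^+ 2 by ring.
by rewrite real_normK ?num_real.
Unshelve. all: by end_near.
Qed.

(** The differential of [act] at [v], applied to the direction [p]. *)
Definition dact {R : realType} {n : nat} (v p : 'cV[R]_n) : 'cV[R]_n :=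
  \col_i (3 * Num.max (v i 0) 0 ^+ 2 * p i 0).

(* A layer acting on a jet [(v, p)]: the value of the previous layer together
   with its derivative in a fixed direction. *)
Definition layer_jet {R : realType} {m n : nat} (J : 'cV[R]_n * 'cV[R]_n)
    (A : 'M[R]_(m, n) * 'cV[R]_m) : 'cV[R]_m * 'cV[R]_m :=
  (A.1 *m act J.1 + A.2, A.1 *m dact J.1 J.2).

(** First-order jet at 0 of a curve of vectors, stated per coordinate so that only derivatives of
    real functions occur. *)
Definition is_jet {R : realType} {n : nat} (f : R -> 'cV[R]_n) (J : 'cV[R]_n * 'cV[R]_n) :=
  f 0 = J.1 /\ forall i, is_derive (0 : R) (1 : R) (fun t => f t i 0) (J.2 i 0).

(** Chain rule, coordinate by coordinate: each output is a fixed linear combination of activated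
    inputs plus a constant. *)
Lemma is_jet_layer {R : realType} {m n : nat} {f : R -> 'cV[R]_n} {J}
    (A : 'M[R]_(m, n) * 'cV[R]_m) :
  is_jet f J -> is_jet (fun t => A.1 *m act (f t) + A.2) (layer_jet J A).
Proof.
move=> [f0 df]; split; first by rewrite f0.
move=> i /=.
have -> : (fun t => (A.1 *m act (f t) + A.2) i 0) =
   (\sum_(j < n) (A.1 i j *: ((@eta3 R) \o (fun t => f t j 0)))) + cst (A.2 i 0).
  apply/funext => t; rewrite !mxE fctE fct_sumE; congr (_ + _).
  by apply: eq_bigr => j _; rewrite !mxE.
(* The added 0 is the derivative of the bias. *)
have -> : (A.1 *m dact J.1 J.2) i 0 =
   \sum_(j < n) (A.1 i j *: (3 * Num.max (f 0 j 0) 0 ^+ 2 * J.2 j 0)) + 0.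
  by rewrite addr0 mxE f0; apply: eq_bigr => j _; rewrite mxE.
apply: is_deriveD; apply: is_derive_sum => j.
by apply: is_deriveZ; apply: is_derive1_comp => //; exact: is_derive_eta3.
Qed.

Lemma is_jet_foldl {R : realType} {n : nat} (ms : seq ('M[R]_n * 'cV[R]_n)) :
  forall (f : R -> 'cV[R]_n) J, is_jet f J ->
  is_jet (fun t => foldl (fun v p => p.1 *m act v + p.2) (f t) ms)
         (foldl (@layer_jet R n n) J ms).
Proof. by elim: ms => // A ms IH f J fJ /=; apply: IH; apply: is_jet_layer. Qed.

Lemma is_jet_affine {R : realType} {d n : nat} (A : 'M[R]_(n, d)) (b : 'cV[R]_n)
    (x e : 'rV[R]_d) :
  is_jet (fun t : R => A *m (t *: e + x)^T + b) (A *m x^T + b, A *m e^T).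
Proof.
split; first by rewrite /= scale0r add0r.
move=> i /=.
have -> : (fun t : R => (A *m (t *: e + x)^T + b) i 0) =
   ((A *m e^T) i 0 *: (@id R)) + cst ((A *m x^T + b) i 0).
  apply/funext => t; rewrite linearD/= linearZ/= mulmxDr -scalemxAr.
  by rewrite -addrA !mxE fctE; congr (_ + _); rewrite mulrC.
rewrite -[X in is_derive _ _ _ X]addr0.
apply: is_deriveD.
rewrite -[X in is_derive _ _ _ X]mulr1.
by apply: is_deriveZ.
Qed.

(** The output layer is one more layer with a one-dimensional value, so the estimate for hidden
    layers applies to it as well. *)
Definition net_jet {R : realType} {d W : nat} (W1 : 'M[R]_(W, d)) (b1 : 'cV[R]_W)
    (ms : seq ('M[R]_W * 'cV[R]_W)) (WL : 'M[R]_(1, W)) (bL : R) (x e : 'rV[R]_d) :=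
  layer_jet (foldl (@layer_jet R W W) (W1 *m x^T + b1, W1 *m e^T) ms) (WL, const_mx bL).

Lemma derive_net {R : realType} {d W : nat} (W1 : 'M[R]_(W, d)) (b1 : 'cV[R]_W)
    (ms : seq ('M[R]_W * 'cV[R]_W)) (WL : 'M[R]_(1, W)) (bL : R) (x e : 'rV[R]_d) :
  'D_e (net W1 b1 ms WL bL) x = (net_jet W1 b1 ms WL bL x e).2 0 0.
Proof.
have [_ /(_ 0) H] := is_jet_layer (WL, const_mx bL)
  (is_jet_foldl ms _ _ (is_jet_affine W1 b1 x e)).
suff D : is_derive x e (net W1 b1 ms WL bL) ((net_jet W1 b1 ms WL bL x e).2 0 0).
  exact: derive_val.
apply: is_derive_line.
congr (is_derive _ _ _ _): H.
by apply/funext => t; rewrite /net /= !mxE.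
Qed.

Lemma derive_affine {R : realType} (d : nat) (w : 'M[R]_(1, d)) (b : R) (x e : 'rV[R]_d) :
  'D_e (fun x => (w *m x^T) 0 0 + b) x = (w *m e^T) 0 0.
Proof.
have [_ /(_ 0) H] := is_jet_affine w (const_mx b) x e.
suff D : is_derive x e (fun x => (w *m x^T) 0 0 + b) ((w *m e^T) 0 0).
  exact: derive_val.
apply: is_derive_line.
congr (is_derive _ _ _ _): H.
by apply/funext => t; rewrite !mxE.
Qed.

(** * Propagation of weight perturbations through the layers *)

(** Sizes and distance travel together, because the distance between two products depends on
    both. *)
Definition mx_close {R : realType} {m n : nat} (B e : R) (A A' : 'M[R]_(m, n)) :=
  forall i j, [/\ `|A i j| <= B, `|A' i j| <= B & `|A i j - A' i j| <= e].

Lemma mx_close_le {R : realType} {m n : nat} (B e B' e' : R) (A A' : 'M[R]_(m, n)) :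
  B <= B' -> e <= e' -> mx_close B e A A' -> mx_close B' e' A A'.
Proof.
move=> BB' ee' H i j; have [h1 h2 h3] := H i j.
by split; [exact: le_trans h1 BB'|exact: le_trans h2 BB'|exact: le_trans h3 ee'].
Qed.

Lemma mx_closeD {R : realType} {m n : nat} (B1 B2 e1 e2 : R) (A1 A1' A2 A2' : 'M[R]_(m, n)) :
  mx_close B1 e1 A1 A1' -> mx_close B2 e2 A2 A2' ->
  mx_close (B1 + B2) (e1 + e2) (A1 + A2) (A1' + A2').
Proof.
move=> H1 H2 i j; have [a b c] := H1 i j; have [a' b' c'] := H2 i j.
rewrite !mxE opprD addrACA.
by split; apply: (le_trans (ler_normD _ _)); apply: lerD.
Qed.

(** Entrywise, A u - A' u' = A (u - u') + (A - A') u', a sum of [n] terms. *)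
Lemma mx_closeM {R : realType} {m n p : nat} (B e U D : R)
    (A A' : 'M[R]_(m, n)) (u u' : 'M[R]_(n, p)) :
  mx_close B e A A' -> mx_close U D u u' ->
  mx_close (n%:R * (B * U)) (n%:R * (B * D + e * U)) (A *m u) (A' *m u').
Proof.
move=> HA Hu i j; rewrite !mxE.
have sum_le (F : 'I_n -> R) (c : R) : (forall k, `|F k| <= c) -> `|\sum_k F k| <= n%:R * c.
  move=> Fc; apply: (le_trans (ler_norm_sum _ _ _)).
  apply: (@le_trans _ _ (\sum_(k < n) c)); first exact: ler_sum.
  by rewrite sumr_const card_ord mulr_natl.
rewrite -sumrB; split; apply: sum_le => k;
  have [a b c] := HA i k; have [a' b' c'] := Hu k j.
- by rewrite normrM ler_pM.
- by rewrite normrM ler_pM.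
- have -> : A i k * u k j - A' i k * u' k j =
    A i k * (u k j - u' k j) + (A i k - A' i k) * u' k j by ring.
  apply: (le_trans (ler_normD _ _)); rewrite !normrM.
  by apply: lerD; apply: ler_pM.
Qed.

Lemma relu_close {R : realType} (T e v v' : R) : `|v| <= T -> `|v'| <= T -> `|v - v'| <= e ->
  [/\ 0 <= Num.max v 0 <= T, 0 <= Num.max v' 0 <= T & `|Num.max v 0 - Num.max v' 0| <= e].
Proof.
move=> /ler_normlP[v1 v2] /ler_normlP[v1' v2'] /ler_normlP[d1 d2].
have T0 : 0 <= T by lra.
by rewrite ler_norml; split; case: (leP v 0); case: (leP v' 0); lra.
Qed.

(** The difference of cubes factors through [s - s']; the cofactor has three terms, each at most
    [T ^+ 2]. *)
Lemma act_close {R : realType} {n : nat} (T e : R) (v v' : 'cV[R]_n) :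
  mx_close T e v v' -> mx_close (T ^+ 3) (3 * T ^+ 2 * e) (act v) (act v').
Proof.
move=> H i j; rewrite !mxE /eta3.
have [a b c] := H i j.
have [] := relu_close _ _ _ _ a b c.
set s := Num.max _ _; set s' := Num.max _ _ => /andP[s0 sT] /andP[s0' sT'] ss'.
rewrite (ger0_norm (exprn_ge0 3 s0)) (ger0_norm (exprn_ge0 3 s0')).
have T0 : 0 <= T by exact: le_trans sT.
split; [exact: lerXn2r|exact: lerXn2r|].
have -> : s ^+ 3 - s' ^+ 3 = (s ^+ 2 + s * s' + s' ^+ 2) * (s - s') by ring.
rewrite normrM; apply: ler_pM => //.
rewrite ger0_norm ?addr_ge0 ?mulr_ge0 ?exprn_ge0//.
have h1 : s ^+ 2 <= T ^+ 2 by apply: lerXn2r.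
have h2 : s' ^+ 2 <= T ^+ 2 by apply: lerXn2r.
have h3 : s * s' <= T * T by apply: ler_pM.
lra.
Qed.

(** The constant is 9 = 3 (2 + 1): 2 comes from s^2 - s'^2 = (s + s')(s - s'), and 1 from the change
    of [p]. *)
Lemma dact_close {R : realType} {n : nat} (T e : R) (v v' p p' : 'cV[R]_n) :
  mx_close T e v v' -> mx_close T e p p' ->
  mx_close (3 * T ^+ 3) (9 * T ^+ 2 * e) (dact v p) (dact v' p').
Proof.
move=> H H' i j; rewrite !mxE.
have [a b c] := H i 0; have [a' b' c'] := H' i 0.
have [] := relu_close _ _ _ _ a b c.
set s := Num.max _ _; set s' := Num.max _ _ => /andP[s0 sT] /andP[s0' sT'] ss'.
have T0 : 0 <= T by exact: le_trans sT.
have h1 : s ^+ 2 <= T ^+ 2 by apply: lerXn2r.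
have h2 : s' ^+ 2 <= T ^+ 2 by apply: lerXn2r.
have q1 : 0 <= s ^+ 2 by apply: sqr_ge0.
have q2 : 0 <= s' ^+ 2 by apply: sqr_ge0.
have T3 : 3 * T ^+ 3 = 3 * T ^+ 2 * T by ring.
have B3 (r q : R) : 0 <= r ^+ 2 <= T ^+ 2 -> `|q| <= T -> `|3 * r ^+ 2 * q| <= 3 * T ^+ 3.
  move=> /andP[r0 rT] qT; rewrite T3 normrM (ger0_norm (mulr_ge0 _ r0))//.
  by apply: ler_pM => //; [exact: mulr_ge0|exact: ler_wpM2l].
split; try by apply: B3; rewrite ?q1 ?q2.
have -> : 3 * s ^+ 2 * p i 0 - 3 * s' ^+ 2 * p' i 0 =
  3 * ((s + s') * p i 0 * (s - s') + s' ^+ 2 * (p i 0 - p' i 0)) by ring.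
rewrite normrM ger0_norm//.
have -> : 9 * T ^+ 2 * e = 3 * (2 * T * T * e + T ^+ 2 * e) by ring.
rewrite ler_pM2l//; apply: (le_trans (ler_normD _ _)).
apply: lerD; last by rewrite normrM (ger0_norm q2); apply: ler_pM.
have ss0 := addr_ge0 s0 s0'.
rewrite normrM normrM (ger0_norm ss0).
apply: ler_pM => //; first exact: mulr_ge0.
by apply: ler_pM => //; lra.
Qed.

(** Writing the distance as [e * T] leaves a single quantity [T] to follow from layer to layer. *)
Definition jet_close {R : realType} {n : nat} (e T : R) (J J' : 'cV[R]_n * 'cV[R]_n) :=
  mx_close T (e * T) J.1 J'.1 /\ mx_close T (e * T) J.2 J'.2.

Definition layer_close {R : realType} {m n : nat} (B e : R)
    (A A' : 'M[R]_(m, n) * 'cV[R]_m) :=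
  mx_close B e A.1 A'.1 /\ mx_close B e A.2 A'.2.

Lemma jet_close_le {R : realType} {n : nat} (e T T' : R) (J J' : 'cV[R]_n * 'cV[R]_n) :
  0 <= e -> T <= T' -> jet_close e T J J' -> jet_close e T' J J'.
Proof. by move=> e0 TT' [h1 h2]; split; apply: (mx_close_le _ _ _ _ _ _ TT' (ler_wpM2l e0 TT')). Qed.

(** The largest coefficient that arises is 9 + 3 = 12, in the distance of the derivative components;
    13 dominates all of them. *)
Lemma layer_jet_close {R : realType} {m n : nat} (B e T Q : R)
    (A A' : 'M[R]_(m, n) * 'cV[R]_m) (J J' : 'cV[R]_n * 'cV[R]_n) :
  (0 < n)%N -> 1 <= B -> 0 <= e -> 1 <= T -> 13 * n%:R * B <= Q ->
  layer_close B e A A' -> jet_close e T J J' ->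
  jet_close e (Q * T ^+ 3) (layer_jet J A) (layer_jet J' A').
Proof.
move=> n0 B1 e0 T1 QB [HA Hb] [Hv Hp].
have n1 : 1 <= n%:R :> R by rewrite ler1n.
have T3 : 1 <= T ^+ 3 by apply: exprn_ege1.
have nT : 1 <= n%:R * T ^+ 3 by apply: mulr_ege1.
have BT : B <= B * n%:R * T ^+ 3 by rewrite -mulrA ler_peMr//; lra.
have nB : n%:R * T ^+ 3 <= B * n%:R * T ^+ 3 by rewrite -mulrA ler_peMl//; lra.
have nBT : 1 <= B * n%:R * T ^+ 3 by lra.
have QT : 13 * n%:R * B * T ^+ 3 <= Q * T ^+ 3 by apply: ler_wpM2r => //; lra.
(* Every bound below is a combination of [Z], [Y], [B] and 1, each of which is at most [Z]. *)
set Z := B * n%:R * T ^+ 3 in BT nB nBT *.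
set Y := n%:R * T ^+ 3 in nT nB *.
have QZ : 13 * Z <= Q * T ^+ 3 by apply: le_trans QT; rewrite /Z; lra.
split => /=.
- apply: mx_close_le (mx_closeD _ _ _ _ _ _ _ _ (mx_closeM _ _ _ _ _ _ _ _ HA (act_close _ _ _ _ Hv)) Hb).
  + by apply: le_trans QZ; rewrite mulrCA mulrA -/Z; lra.
  + apply: le_trans (ler_wpM2l e0 QZ).
    have -> : n%:R * (B * (3 * T ^+ 2 * (e * T)) + e * T ^+ 3) + e = e * (3 * Z + Y + 1).
      by rewrite /Z /Y; ring.
    by rewrite ler_wpM2l//; lra.
- apply: mx_close_le (mx_closeM _ _ _ _ _ _ _ _ HA (dact_close _ _ _ _ _ _ Hv Hp)).
  + apply: le_trans QZ.
    have -> : n%:R * (B * (3 * T ^+ 3)) = 3 * Z by rewrite /Z; ring.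
    by lra.
  + apply: le_trans (ler_wpM2l e0 QZ).
    have -> : n%:R * (B * (9 * T ^+ 2 * (e * T)) + e * (3 * T ^+ 3)) = e * (9 * Z + 3 * Y).
      by rewrite /Z /Y; ring.
    by rewrite ler_wpM2l//; lra.
Qed.

Lemma affine_jet_close {R : realType} {d n : nat} (B e Q : R)
    (A A' : 'M[R]_(n, d)) (b b' : 'cV[R]_n) (x v : 'rV[R]_d) :
  1 <= B -> 0 <= e -> d.+1%:R * B <= Q ->
  (forall i, `|x 0 i| <= 1) -> (forall i, `|v 0 i| <= 1) ->
  mx_close B e A A' -> mx_close B e b b' ->
  jet_close e Q (A *m x^T + b, A *m v^T) (A' *m x^T + b', A' *m v^T).
Proof.
move=> B1 e0 QB x1 v1 HA Hb.
(* Both networks see the same input and direction, hence distance 0. *)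
have cl (y : 'rV[R]_d) : (forall i, `|y 0 i| <= 1) -> mx_close 1 0 y^T y^T.
  by move=> y1 i j; rewrite !mxE ord1 subrr normr0.
have dQ : d%:R * B + B <= Q by apply: le_trans QB; rewrite -natr1; lra.
have dd : d%:R <= d%:R * B by rewrite ler_peMr.
split => /=.
- apply: mx_close_le (mx_closeD _ _ _ _ _ _ _ _ (mx_closeM _ _ _ _ _ _ _ _ HA (cl x x1)) Hb).
  + by rewrite mulr1.
  + rewrite mulr0 add0r mulr1.
    have -> : d%:R * e + e = e * (d%:R + 1) by ring.
    by rewrite ler_wpM2l//; lra.
- apply: mx_close_le (mx_closeM _ _ _ _ _ _ _ _ HA (cl v v1)).
  + by rewrite mulr1; lra.
  + by rewrite mulr0 add0r mulr1 mulrC ler_wpM2l//; lra.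
Qed.

(** Here [l] counts the layers already passed; it is general so that the induction on the list can
    start at any depth. *)
Lemma foldl_jet_close {R : realType} {n : nat} (B e Q : R)
    (ms ms' : seq ('M[R]_n * 'cV[R]_n)) :
  (0 < n)%N -> 1 <= B -> 0 <= e -> 13 * n%:R * B <= Q -> size ms = size ms' ->
  (forall k, (k < size ms)%N -> layer_close B e (nth (0, 0) ms k) (nth (0, 0) ms' k)) ->
  forall l J J', jet_close e (Q ^+ (3 ^ l).-1) J J' ->
  jet_close e (Q ^+ (3 ^ (size ms + l)).-1)
    (foldl (@layer_jet R n n) J ms) (foldl (@layer_jet R n n) J' ms').
Proof.
move=> n0 B1 e0 QB.
elim: ms ms' => [|A ms IH] [|A' ms']//= [sz] H l J J' HJ.
rewrite addSnnS; apply: IH => //; first by move=> k kn; exact: (H k.+1).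
have n1 : 1 <= n%:R :> R by rewrite ler1n.
have nB : 1 <= n%:R * B by apply: mulr_ege1.
have Q1 : 1 <= Q by lra.
have := layer_jet_close _ _ _ _ _ _ _ _ n0 B1 e0 (exprn_ege1 _ Q1) QB (H 0%N isT) HJ.
apply: jet_close_le => //.
(* Cubing and one more factor [Q] give the exponent 3 (3^l - 1) + 1 = 3^(l+1) - 2, below the claimed
   3^(l+1) - 1. *)
rewrite -exprM -exprS; apply: ler_weXn2l => //.
by rewrite expnS; have := expn_gt0 3 l; lia.
Qed.

Lemma net_jet_close {R : realType} {d W : nat} (B e Q : R)
    (W1 W1' : 'M[R]_(W, d)) (b1 b1' : 'cV[R]_W) (ms ms' : seq ('M[R]_W * 'cV[R]_W))
    (WL WL' : 'M[R]_(1, W)) (bL bL' : R) (x v : 'rV[R]_d) :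
  (0 < W)%N -> 1 <= B -> 0 <= e -> 13 * W%:R * B <= Q -> d.+1%:R * B <= Q ->
  (forall i, `|x 0 i| <= 1) -> (forall i, `|v 0 i| <= 1) ->
  mx_close B e W1 W1' -> mx_close B e b1 b1' ->
  size ms = size ms' ->
  (forall k, (k < size ms)%N -> layer_close B e (nth (0, 0) ms k) (nth (0, 0) ms' k)) ->
  mx_close B e WL WL' -> [/\ `|bL| <= B, `|bL'| <= B & `|bL - bL'| <= e] ->
  jet_close e (Q ^+ (3 ^ (size ms).+2).-1)
    (net_jet W1 b1 ms WL bL x v) (net_jet W1' b1' ms' WL' bL' x v).
Proof.
move=> W0 B1 e0 QW Qd x1 v1 HW1 Hb1 sz Hms HWL HbL.
have W1_ : 1 <= W%:R :> R by rewrite ler1n.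
have nB : 1 <= W%:R * B by apply: mulr_ege1.
have Q1 : 1 <= Q by lra.
have H1 := affine_jet_close _ _ _ _ _ _ _ _ _ B1 e0 Qd x1 v1 HW1 Hb1.
(* The first layer gives the bound [Q], weakened to Q^2 to fit the exponent at [l = 1]. *)
have H2 : jet_close e (Q ^+ (3 ^ 1).-1) (W1 *m x^T + b1, W1 *m v^T) (W1' *m x^T + b1', W1' *m v^T).
  by apply: jet_close_le H1 => //; rewrite /= ler_peMl//; lra.
have H3 := foldl_jet_close _ _ _ _ _ W0 B1 e0 QW sz Hms _ _ _ H2.
have HL : layer_close B e (WL, const_mx bL : 'cV_1) (WL', const_mx bL').
  by split => // i j; rewrite !mxE.
have := layer_jet_close _ _ _ _ _ _ _ _ W0 B1 e0 (exprn_ege1 _ Q1) QW HL H3.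
apply: jet_close_le => //.
rewrite -exprM -exprS; apply: ler_weXn2l => //.
by rewrite addn1 [(3 ^ (size ms).+2)%N]expnS; have := expn_gt0 3 (size ms).+1; lia.
Qed.

(** * From partial derivatives to gradient norms *)

(** With e_i = |a_i - b_i|, the bounds |b_i| <= s and e_i <= E give a_i^2 <= b_i^2 + (2 s + E) e_i;
    these right-hand sides add up to (s + E)^2. Exchanging the two vectors gives the other
    inequality. *)
Lemma l2norm_dist {R : realType} {d : nat} (u v : 'I_d -> R) :
  `|Num.sqrt (\sum_i u i ^+ 2) - Num.sqrt (\sum_i v i ^+ 2)| <= \sum_i `|u i - v i|.
Proof.
have key (a b : 'I_d -> R) :
    Num.sqrt (\sum_i a i ^+ 2) <= Num.sqrt (\sum_i b i ^+ 2) + \sum_i `|a i - b i|.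
  set s := Num.sqrt (\sum_i b i ^+ 2); set E := \sum_i `|a i - b i|.
  have E0 : 0 <= E by apply: sumr_ge0.
  have s0 : 0 <= s by apply: sqrtr_ge0.
  have ss : s ^+ 2 = \sum_i b i ^+ 2 by rewrite sqr_sqrtr// sumr_ge0// => i _; apply: sqr_ge0.
  rewrite -[leRHS]ger0_norm ?addr_ge0// -sqrtr_sqr ler_wsqrtr//.
  have -> : (s + E) ^+ 2 = \sum_i (b i ^+ 2 + (2 * s + E) * `|a i - b i|).
    by rewrite big_split/= -mulr_sumr -/E -ss; ring.
  apply: ler_sum => i _.
  have bs : `|b i| <= s.
    rewrite -sqrtr_sqr ler_wsqrtr// (bigD1 i)//= lerDl sumr_ge0// => j _.
    exact: sqr_ge0.
  have eE : `|a i - b i| <= E by rewrite /E (bigD1 i)//= lerDl sumr_ge0.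
  have e0 := normr_ge0 (a i - b i).
  have aa : `|a i| <= `|b i| + `|a i - b i|.
    by rewrite -[X in `|X| <= _](subrKC (b i) (a i)); exact: ler_normD.
  rewrite -[a i ^+ 2]real_normK ?num_real// -[b i ^+ 2]real_normK ?num_real//.
  have a0 := normr_ge0 (a i); have b0 := normr_ge0 (b i).
  have h1 : `|a i| ^+ 2 <= (`|b i| + `|a i - b i|) ^+ 2 by apply: lerXn2r => //; rewrite nnegrE addr_ge0.
  have h2 := ler_wpM2r e0 bs; have h3 := ler_wpM2r e0 eE.
  nra.
have h1 := key u v; have h2 := key v u.
have E : \sum_i `|v i - u i| = \sum_i `|u i - v i| by apply: eq_bigr => i _; exact: distrC.
rewrite E in h2.
by rewrite ler_distl; apply/andP; split; lra.
Qed.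

Lemma gradnorm_close {R : realType} {d : nat} (F F' : 'rV[R]_d -> R) (x : 'rV[R]_d) (e : R) :
  (forall i, `|'D_(delta_mx 0 i) F x - 'D_(delta_mx 0 i) F' x| <= e) ->
  `|gradnorm F x - gradnorm F' x| <= d%:R * e.
Proof.
move=> H; apply: (le_trans (l2norm_dist _ _)).
apply: (@le_trans _ _ (\sum_(i < d) e)); first by apply: ler_sum => i _; exact: H.
by rewrite sumr_const card_ord mulr_natl.
Qed.

(** * Covers obtained from finite codes *)

(** Cover sizes are natural numbers, so once one exists the infimum is attained at the least. *)
Lemma covers_covering_number {R : realType} {d : nat} (delta : R)
    (A : set ('rV[R]_d -> R)) (m : nat) : covers delta A m ->
  exists2 n : nat, (n <= m)%N & covering_number delta A = (n%:R)%:E.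
Proof.
move=> Hm.
have ex : exists k, `[<covers delta A k>] by exists m; apply/asboolP.
case: (ex_minnP ex) => n /asboolP Hn min; exists n.
  by apply: min; apply/asboolP.
apply/eqP; rewrite eq_le; apply/andP; split.
  by apply: ereal_inf_lbound; exists n.
apply: le_ereal_inf_tmp => _ [k Hk <-].
by rewrite lee_fin ler_nat; apply: min; apply/asboolP.
Qed.

(** One member is chosen per code. A code is a relation, so a function may have several parameter
    vectors and several codes. *)
Lemma covers_of_code {R : realType} {d : nat} (T : finType) (delta : R)
    (A : set ('rV[R]_d -> R)) (code : ('rV[R]_d -> R) -> T -> Prop) :
  (forall g, A g -> exists t, code g t) ->
  (forall g g' t, A g -> A g' -> code g t -> code g' t ->
     forall x, @Omega R d x -> `|g x - g' x| <= delta) ->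
  exists2 m : nat, (m <= #|T|)%N & covers delta A m.
Proof.
move=> exc close.
have [[g0 Ag0]|A0] := pselect (exists g, A g); last first.
  (* Centers must lie in the family, so an empty family is covered by zero balls. *)
  exists 0%N => //; exists (fun=> cst 0); split; first by case.
  by move=> g Ag; case: A0; exists g.
(* A code that no member has is sent to [g0], which keeps all centers in [A]. *)
pose rep t := xget g0 (fun g => A g /\ code g t).
have Arep t : A (rep t) by rewrite /rep; case: xgetP => // g _ [].
exists #|T| => //; exists (fun i => rep (enum_val i)); split; first by move=> i.
move=> g Ag; have [t gt] := exc g Ag.
exists (enum_rank t) => x Ox; rewrite enum_rankK.
have [Ar cr] : A (rep t) /\ code (rep t) t.
  by apply: (@xgetPex _ g0 (fun g => A g /\ code g t)); exists g.
exact: close gt cr x Ox.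
Qed.

(* A sparse bounded parameter vector is encoded by listing [S] indices that
   cover its support, each with the grid cell of width [e] of its entry. *)
Lemma covers_sparse_params {R : realType} {d : nat} (I : finType) (i0 : I) (S : nat)
    (B e delta : R) (A : set ('rV[R]_d -> R))
    (P : ('rV[R]_d -> R) -> (I -> R) -> Prop) :
  0 < e ->
  (forall g, A g -> exists th, [/\ P g th, forall i, `|th i| <= B &
      (\sum_i (th i != 0%R : nat) <= S)%N]) ->
  (forall g g' th th', P g th -> P g' th' ->
      (forall i, [/\ `|th i| <= B, `|th' i| <= B & `|th i - th' i| <= e]) ->
      forall x, @Omega R d x -> `|g x - g' x| <= delta) ->
  exists2 m : nat, (m <= (#|I| * (Num.truncn (2 * B / e)).+1) ^ S)%N & covers delta A m.
Proof.
move=> e0 par close.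
(* Shifting by [B] makes the argument nonnegative, where [Num.truncn] is the floor. *)
pose cell (t : R) := Num.truncn ((t + B) / e).
set M := (Num.truncn (2 * B / e)).+1.
have cellM t : `|t| <= B -> (cell t < M)%N.
  move=> /ler_normlP[t1 t2]; rewrite ltnS; apply: le_truncn.
  by rewrite ler_pM2r ?invr_gt0//; lra.
have cell_eq t t' : `|t| <= B -> `|t'| <= B -> cell t = cell t' -> `|t - t'| <= e.
  have itv s : `|s| <= B -> (cell s)%:R * e <= s + B < (cell s).+1%:R * e.
    move=> /ler_normlP[s1 s2].
    have /truncn_itv : 0 <= (s + B) / e by apply: divr_ge0; [lra|exact: ltW].
    by rewrite ler_pdivlMr// ltr_pdivrMr.
  move=> /itv/andP[t1 t2] /itv/andP[t1' t2'] E.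
  rewrite E in t1 t2; rewrite ler_norml; apply/andP.
  rewrite -natr1 mulrDl mul1r in t2 t2'; split; lra.
have -> : ((#|I| * M) ^ S)%N = #|{: {ffun 'I_S -> I * 'I_M}}|.
  by rewrite card_ffun card_prod !card_ord.
(* Listed indices may repeat and may carry a zero entry, so a list of length exactly [S] also serves
   smaller supports. *)
pose code g (tau : {ffun 'I_S -> I * 'I_M}) := exists th, [/\ P g th, forall i, `|th i| <= B,
   forall s, cell (th (tau s).1) = (tau s).2 &
   forall i, th i != 0 -> exists s, (tau s).1 = i].
apply: (covers_of_code _ _ _ code).
- move=> g /par[th [Pg thB thS]].
  pose supp := enum [pred i | th i != 0].
  have szS : (size supp <= S)%N.
    rewrite -cardE -sum1_card big_mkcond/=; apply: leq_trans thS.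
    by apply: leq_sum => i _; rewrite inE; case: (th i != 0).
  (* Past the end of the support, [nth] returns [i0], recorded with its own true cell. *)
  exists [ffun s : 'I_S => let i := nth i0 supp s in (i, Ordinal (cellM _ (thB i)))].
  exists th; split => //.
  + by move=> s; rewrite ffunE.
  + move=> i thi.
    have isupp : i \in supp by rewrite mem_enum.
    have iS : (index i supp < S)%N by apply: leq_trans szS; rewrite index_mem.
    by exists (Ordinal iS); rewrite ffunE/= nth_index.
- move=> g g' tau _ _ [th [Pg thB thc ths]] [th' [Pg' thB' thc' ths']].
  apply: (close _ _ _ _ Pg Pg') => i; split => //.
  (* An index in either support is listed in the common code; outside both supports the two entries
     vanish. *)
  have same s : (tau s).1 = i -> `|th i - th' i| <= e.
    by move=> <-; apply: cell_eq => //; rewrite thc thc'.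
  have [/ths[s /same//]|/negPn/eqP thi] := boolP (th i != 0).
  have [/ths'[s /same//]|/negPn/eqP thi'] := boolP (th' i != 0).
  by rewrite thi thi' subrr normr0 ltW.
Qed.

(** * Networks as sparse parameter vectors, and covers of the gradient families *)

(** One summand per block of weights, with [K] the number of hidden layers between the first and the
    output layer. *)
Definition net_index (d W K : nat) : finType :=
  ('I_W * 'I_d + 'I_W + ('I_K * ('I_W * 'I_W) + 'I_K * 'I_W) + 'I_W + unit)%type.

Definition net_param {R : realType} {d W : nat} (K : nat) (W1 : 'M[R]_(W, d)) (b1 : 'cV[R]_W)
    (ms : seq ('M[R]_W * 'cV[R]_W)) (WL : 'M[R]_(1, W)) (bL : R)
    (i : net_index d W K) : R :=
  match i with
  | inl (inl (inl (inl p))) => W1 p.1 p.2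
  | inl (inl (inl (inr j))) => b1 j 0
  | inl (inl (inr (inl p))) => (nth (0, 0) ms p.1).1 p.2.1 p.2.2
  | inl (inl (inr (inr p))) => (nth (0, 0) ms p.1).2 p.2 0
  | inl (inr j) => WL 0 j
  | inr _ => bL
  end.

(** Turns the sparsity budget of [Phi] into the support bound that [covers_sparse_params]
    expects. *)
Lemma nnz_net_param {R : realType} {d W : nat} (W1 : 'M[R]_(W, d)) (b1 : 'cV[R]_W)
    (ms : seq ('M[R]_W * 'cV[R]_W)) (WL : 'M[R]_(1, W)) (bL : R) :
  (\sum_i (net_param (size ms) W1 b1 ms WL bL i != 0%R : nat) =
   nnz W1 + nnz b1 + \sum_(p <- ms) (nnz p.1 + nnz p.2) + nnz WL + (bL != 0%R : nat))%N.
Proof.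
rewrite !big_sumType /= (big_pred1 tt); last by case.
congr (_ + _ + _ + _ + _)%N.
- by rewrite /nnz pair_bigA.
- by rewrite /nnz; apply: eq_bigr => i _; rewrite big_ord1.
- rewrite (big_nth (0%R, 0%R)) big_mkord big_split/=; congr (_ + _)%N.
    rewrite -(pair_bigA _ (fun (k : 'I_(size ms)) (q : 'I_W * 'I_W) => ((nth (0%R, 0%R) ms k).1 q.1 q.2 != 0%R : nat)))/=.
    by apply: eq_bigr => k _; rewrite /nnz pair_bigA.
  rewrite -(pair_bigA _ (fun (k : 'I_(size ms)) (q : 'I_W) => ((nth (0%R, 0%R) ms k).2 q 0 != 0%R : nat)))/=.
  by apply: eq_bigr => k _; rewrite /nnz; apply: eq_bigr => i _; rewrite big_ord1.
- by rewrite /nnz big_ord1.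
Qed.

Lemma Omega_norm_le1 {R : realType} {d : nat} (x : 'rV[R]_d) :
  @Omega R d x -> forall i, `|x 0 i| <= 1.
Proof. by move=> Ox i; have /andP[x0 x1] := Ox i; rewrite ger0_norm. Qed.

Lemma delta_mx_norm_le1 {R : realType} {d : nat} (k i : 'I_d) :
  `|(delta_mx 0 k : 'rV[R]_d) 0 i| <= 1.
Proof. by rewrite mxE eqxx /=; case: (_ == _); rewrite ?normr1 ?normr0. Qed.

(** An affine map has [d + 1] parameters and a constant gradient. The exponent 3 = 3^1 is chosen to
    match the radius for deeper networks. *)
Lemma covers_gradPhi1 {R : realType} {d W S : nat} (B e Q : R) :
  1 <= B -> 0 < e -> d.+1%:R * B <= Q ->
  exists2 m : nat, (m <= (d.+1 * (Num.truncn (2 * B / e)).+1) ^ S)%N &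
    covers (e * Q ^+ 3) (gradPhi d 1 W S B) m.
Proof.
move=> B1 e0 QB.
have d1 : 1 <= d.+1%:R :> R by rewrite ler1n.
have Q1 : 1 <= Q by apply: le_trans QB; apply: mulr_ege1.
have dQ : d%:R <= Q by apply: le_trans QB; rewrite -[leLHS]mulr1 ler_pM// ler_nat.
pose I : finType := ('I_1 * 'I_d + unit)%type.
pose P (g : 'rV[R]_d -> R) (th : I -> R) := exists (w : 'M[R]_(1, d)) (b : R),
  th = (fun i => match i with inl p => w p.1 p.2 | inr _ => b end) /\
  g = gradnorm (fun x => (w *m x^T) 0 0 + b).
have -> : d.+1 = #|I| by rewrite card_sum card_prod !card_ord card_unit mul1n addn1.
apply: (covers_sparse_params I (inr tt) S B e _ _ P e0).
- move=> g [F [[[_ [w [b [nz [wB [bB FE]]]]]]|[]//] gE]].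
  exists (fun i => match i with inl p => w p.1 p.2 | inr _ => b end); split.
  + by exists w, b; split => //; rewrite gE FE.
  + by case=> [p|_].
  + by rewrite big_sumType (big_pred1 tt)/=; [move: nz; rewrite /nnz pair_bigA|case].
- move=> g g' th th' [w [b [-> ->]]] [w' [b' [-> ->]]] H x Ox.
  have Hw : mx_close B e w w' by move=> i j; exact: (H (inl (i, j))).
  have Hb : mx_close B e (const_mx b : 'cV_1) (const_mx b').
    by move=> i j; rewrite !mxE; exact: (H (inr tt)).
  apply: (@le_trans _ _ (d%:R * (e * Q))).
    apply: gradnorm_close => k; rewrite !derive_affine.
    have [_ /(_ 0 0)[_ _]] := affine_jet_close _ _ _ _ _ _ _ _ _ B1 (ltW e0) QB
      (Omega_norm_le1 _ Ox) (delta_mx_norm_le1 k) Hw Hb.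
    by [].
  (* One factor [Q] absorbs [d]; the other is dropped since [Q >= 1]. *)
  have -> : e * Q ^+ 3 = Q * (e * Q) * Q by ring.
  apply: (@le_trans _ _ (Q * (e * Q))).
    by rewrite ler_wpM2r// mulr_ge0 ?ltW//; lra.
  by rewrite ler_peMr// !mulr_ge0// ?(ltW e0)//; lra.
Qed.

Lemma covers_gradPhi {R : realType} {d L W S : nat} (B e Q : R) :
  (2 <= L)%N -> (0 < W)%N -> 1 <= B -> 0 < e -> 13 * W%:R * B <= Q -> d.+1%:R * B <= Q ->
  exists2 m : nat,
    (m <= (#|net_index d W (L - 2)| * (Num.truncn (2 * B / e)).+1) ^ S)%N &
    covers (e * Q ^+ (3 ^ L)) (gradPhi d L W S B) m.
Proof.
move=> L2 W0 B1 e0 QW QB.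
have d1 : 1 <= d.+1%:R :> R by rewrite ler1n.
have Q1 : 1 <= Q by apply: le_trans QB; apply: mulr_ege1.
have dQ : d%:R <= Q by apply: le_trans QB; rewrite -[leLHS]mulr1 ler_pM// ler_nat.
pose P (g : 'rV[R]_d -> R) (th : net_index d W (L - 2) -> R) :=
  exists (W1 : 'M[R]_(W, d)) (b1 : 'cV[R]_W)
    (ms : seq ('M[R]_W * 'cV[R]_W)) (WL : 'M[R]_(1, W)) (bL : R),
  [/\ size ms = (L - 2)%N, th = net_param (L - 2) W1 b1 ms WL bL &
      g = gradnorm (net W1 b1 ms WL bL)].
apply: (covers_sparse_params _ (inr tt) S B e _ _ P e0).
- move=> g [F [[[L1]|[_ [W1 [b1 [ms [WL [bL [sz [nz [HW1 [Hb1 [Hms [HWL [HbL FE]]]]]]]]]]]]]] gE]].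
    by rewrite L1 in L2.
  exists (net_param (L - 2) W1 b1 ms WL bL); split.
  + by exists W1, b1, ms, WL, bL; split => //; rewrite gE FE.
  + move=> [[[[p|j]|[p|p]]|j]|u] //=.
      by have [|h _] := Hms (nth (0, 0) ms p.1); [rewrite mem_nth// sz|exact: h].
    by have [|_ h] := Hms (nth (0, 0) ms p.1); [rewrite mem_nth// sz|exact: h].
  + by rewrite -sz nnz_net_param.
- move=> g g' th th' [W1 [b1 [ms [WL [bL [sz -> ->]]]]]] [W1' [b1' [ms' [WL' [bL' [sz' -> ->]]]]]] H x Ox.
  have szL : (size ms).+2 = L by rewrite sz; lia.
  have HW1 : mx_close B e W1 W1' by move=> i j; exact: (H (inl (inl (inl (inl (i, j)))))).
  have Hb1 : mx_close B e b1 b1'.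
    by move=> i j; rewrite ord1; exact: (H (inl (inl (inl (inr i))))).
  have HWL : mx_close B e WL WL' by move=> i j; rewrite ord1; exact: (H (inl (inr j))).
  have Hms k : (k < size ms)%N -> layer_close B e (nth (0, 0) ms k) (nth (0, 0) ms' k).
    rewrite sz => kL; split => i j.
      exact: (H (inl (inl (inr (inl (Ordinal kL, (i, j))))))).
    by rewrite ord1; exact: (H (inl (inl (inr (inr (Ordinal kL, i)))))).
  (* The factor [Q] saved by the predecessor in the exponent absorbs the [d] from summing partial
     derivatives. *)
  have -> : e * Q ^+ (3 ^ L) = Q * (e * Q ^+ (3 ^ L).-1).
    by rewrite mulrCA -exprS prednK// expn_gt0.
  apply: (@le_trans _ _ (d%:R * (e * Q ^+ (3 ^ L).-1))); last first.
    apply: ler_wpM2r => //; apply: mulr_ge0; first exact: ltW.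
    by apply: exprn_ge0; lra.
  apply: gradnorm_close => k; rewrite !derive_net.
  have [_] := net_jet_close _ _ _ _ _ _ _ _ _ _ _ _ _ _ _ W0 B1 (ltW e0) QW QB
    (Omega_norm_le1 _ Ox) (delta_mx_norm_le1 k) HW1 Hb1 (etrans sz (esym sz')) Hms HWL (H (inr tt)).
  by rewrite szL => /(_ 0 0)[].
Qed.

(** * Counting codes and fixing the constants *)

(** Each slot has at most Q^2 (3 B Q^k / delta) <= Q^(k+3) / delta choices, and k + 3 <= 2 k. *)
Lemma ln_code_count {R : realType} (n p S k : nat) (B Q delta : R) :
  1 <= B -> 3 * B <= Q -> 0 < delta -> delta < 1 -> (3 <= k)%N -> p%:R <= Q ^+ 2 ->
  (n <= (p * (Num.truncn (2 * B / (delta / Q ^+ k))).+1) ^ S)%N ->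
  ln (n%:R : R) <= S%:R * (ln delta^-1 + 2 * k%:R * ln Q).
Proof.
move=> B1 BQ d0 d1 k3 pQ nS.
have k2 : (3 + k <= 2 * k)%N by rewrite mul2n -addnn leq_add2r.
have Q1 : 1 <= Q by lra.
have Q0 : 0 < Q by lra.
have Qk1 : 1 <= Q ^+ k by apply: exprn_ege1.
have Qk0 : 0 < Q ^+ k by apply: exprn_gt0.
have D1 : 1 <= delta^-1 by rewrite invf_ge1// ltW.
have D0 : 0 < delta^-1 by rewrite invr_gt0.
have DQ : 1 <= Q ^+ k / delta by apply: mulr_ege1.
pose X := delta^-1 * Q ^+ (2 * k).
have X0 : 0 < X by rewrite mulr_gt0// exprn_gt0.
have lnX : ln X = ln delta^-1 + 2 * k%:R * ln Q.
  rewrite lnM ?posrE ?exprn_gt0// lnXn// -[ln Q *+ _]mulr_natl natrM.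
  by [].
(* For [n = 0] the convention that [ln 0] is 0 leaves a nonnegative right-hand side. *)
have [->|n0] := posnP n.
  by rewrite ln0// mulr_ge0// addr_ge0 ?ln_ge0// mulr_ge0 ?ln_ge0// mulr_ge0.
rewrite -lnX mulr_natl -lnXn// ler_ln ?posrE ?ltr0n ?exprn_gt0//.
apply: (@le_trans _ _ ((p * (Num.truncn (2 * B / (delta / Q ^+ k))).+1) ^ S)%N%:R).
  by rewrite ler_nat.
rewrite natrX natrM; apply: lerXn2r; [by rewrite nnegrE mulr_ge0|by rewrite nnegrE ltW|].
have -> : 2 * B / (delta / Q ^+ k) = 2 * B * (Q ^+ k / delta) by rewrite invf_div.
set Y := Q ^+ k / delta in DQ *.
have : (Num.truncn (2 * B * Y))%:R <= 2 * B * Y.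
  by rewrite truncn_le !mulr_ge0//; lra.
(* Since 1 <= Y <= B Y, the successor of the floor is at most 3 B Y. *)
have h2 : Y <= B * Y by rewrite ler_peMl//; lra.
have h3 : 3 * B * Y <= Q * Y by rewrite ler_wpM2r//; lra.
move=> h1; rewrite -natr1.
apply: (@le_trans _ _ (Q ^+ 2 * (Q * Y))).
  by apply: ler_pM; rewrite ?addr_ge0//; lra.
have -> : Q ^+ 2 * (Q * Y) = delta^-1 * Q ^+ (3 + k) by rewrite exprD /Y; ring.
by rewrite /X; apply: ler_wpM2l; [exact: ltW|exact: ler_weXn2l].
Qed.

(** Each block has at most a multiple of W^2 entries; the square form is what later gives a count of
    at most Q^2. *)
Lemma card_net_index (d W L K : nat) : (0 < W)%N -> (L <= K)%N ->
  (#|net_index d W (L - 2)| <= (13 * d.+1 * K.+1 * W) ^ 2)%N.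
Proof.
move=> W0 LK.
rewrite !card_sum !card_prod !card_ord card_unit.
have h1 : (W * d <= W * W * d)%N by rewrite -mulnA leq_pmull.
have h2 : (W <= W * W)%N by rewrite leq_pmull.
have h3 : (1 <= W * W)%N by rewrite muln_gt0 W0.
have h4 : ((L - 2) * (W * W) <= W * W * K)%N by rewrite mulnC leq_mul2l; apply/orP; right; lia.
have h5 : ((L - 2) * W <= W * W * K)%N by rewrite mulnC; apply: leq_mul => //; lia.
have h6 : (W * W * (d + 3 + 2 * K) <= W * W * (13 * d.+1 * K.+1))%N.
  by rewrite leq_mul2l; apply/orP; right; nia.
have h7 : (W * W * (13 * d.+1 * K.+1) <= (13 * d.+1 * K.+1 * W) ^ 2)%N.
  rewrite expnMn mulnC -[(W ^ 2)%N]/(W * W)%N leq_mul2r; apply/orP; right.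
  by rewrite -[leqLHS]expn1 leq_pexp2l// !muln_gt0.
apply: leq_trans h7; apply: leq_trans h6.
by rewrite !mulnDr; lia.
Qed.

Theorem mainTheorem18 (R : realType) (d : nat) (c1 : R) :
  exists C : R, forall c2 : R, exists N0 : nat, forall N : nat, (N0 <= N)%N ->
  forall (L W S : nat) (B : R),
    (1 <= L)%N -> L%:R <= c1 ->
    (2 <= W)%N -> W%:R <= c2 * N%:R ->
    (1 <= S)%N -> S%:R <= c2 * N%:R ->
    1 <= B -> B <= c2 * N%:R ->
    forall delta : R, 0 < delta -> delta < 1 ->
    exists n : nat,
      covering_number delta (gradPhi d L W S B) = (n%:R)%:E /\
      ln (n%:R) <= C * S%:R * (ln (delta^-1) + 3%:R ^+ L * ln (W%:R * B)).
Proof.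
(* [K] bounds the depth, and [a] collects every factor that [Q = a W B] has to dominate; both depend
   only on [d] and [c1]. *)
pose K := Num.truncn c1; pose a := (13 * d.+1 * K.+1)%N.
have ln2 : 0 < ln (2 : R) by rewrite ln_gt0// ltr1n.
have a1 : 1 <= a%:R :> R by rewrite ler1n !muln_gt0.
have lna : 0 <= ln (a%:R : R) by apply: ln_ge0.
(* As W B >= 2, ln Q = ln a + ln (W B) is at most (1 + ln a / ln 2) ln (W B); the 2 comes from the
   exponent 2 * 3^L. *)
exists (2 * (1 + ln a%:R / ln 2)) => c2; exists 0%N => N _ L W S B L1 Lc W2 _ _ _ B1 _ delta d0 d1.
have LK : (L <= K)%N by rewrite truncn_ge_nat//; apply: le_trans Lc.
have W0 : (0 < W)%N by lia.
have WR : 2 <= W%:R :> R by rewrite ler_nat.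
have WB2 : 2 <= W%:R * B by apply: le_trans WR _; rewrite ler_peMr.
pose Q : R := a%:R * (W%:R * B).
have QE c : (c <= a * W)%N -> c%:R * B <= Q.
  by move=> ca; rewrite /Q mulrA -natrM ler_wpM2r ?ler_nat//; lra.
have QW : 13 * W%:R * B <= Q by rewrite -natrM; apply: QE; rewrite /a; nia.
have Qd : d.+1%:R * B <= Q by apply: QE; rewrite /a; nia.
have Q3 : 3 * B <= Q by apply: (QE 3%N); rewrite /a; nia.
have Q0 : 0 < Q by lra.
have pQ p : (p <= (a * W) ^ 2)%N -> p%:R <= Q ^+ 2.
  move=> pa; apply: (@le_trans _ _ ((a * W)%N%:R ^+ 2)); first by rewrite -natrX ler_nat.
  apply: lerXn2r; rewrite ?nnegrE ?ler0n// ?(ltW Q0)//.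
  by rewrite -[leLHS]mulr1 /Q mulrA -natrM ler_wpM2l.
have card1 : (d.+1 <= (a * W) ^ 2)%N.
  have aW : (d.+1 <= a * W)%N by rewrite /a; nia.
  by apply: (leq_trans aW); rewrite -[leqLHS]expn1 leq_pexp2l// muln_gt0 W0 !muln_gt0.
have k3 : (3 <= 3 ^ L)%N by rewrite -{1}[3%N]expn1 leq_exp2l.
(* The grid width that makes the radius of the covers equal to [delta]. *)
pose e := delta / Q ^+ (3 ^ L).
have Qk : 0 < Q ^+ (3 ^ L) by apply: exprn_gt0.
have e0 : 0 < e by apply: divr_gt0.
have eQ : e * Q ^+ (3 ^ L) = delta by rewrite /e divfK// gt_eqF.
have [p pa [m mS cov]] : exists2 p : nat, (p <= (a * W) ^ 2)%N &
    exists2 m : nat, (m <= (p * (Num.truncn (2 * B / e)).+1) ^ S)%N &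
      covers delta (gradPhi d L W S B) m.
  have [LE|L2] := leqP L 1; last first.
    exists #|net_index d W (L - 2)|; first exact: card_net_index.
    by rewrite -eQ; exact: covers_gradPhi.
  have {}LE : L = 1%N by apply/eqP; rewrite eqn_leq LE.
  exists d.+1; first exact: card1.
  by rewrite -eQ; subst L; exact: covers_gradPhi1.
have [n nm ->] := covers_covering_number _ _ _ cov.
exists n; split => //.
have := ln_code_count _ _ _ _ _ _ _ B1 Q3 d0 d1 k3 (pQ _ pa) (leq_trans nm mS).
move/le_trans; apply.
have lnWB : ln 2 <= ln (W%:R * B) by rewrite ler_ln ?posrE//; lra.
have lnQ : ln Q <= (1 + ln a%:R / ln 2) * ln (W%:R * B).
  rewrite /Q lnM ?posrE; [|lra|lra].
  have : ln (a%:R : R) / ln 2 * ln 2 <= ln a%:R / ln 2 * ln (W%:R * B).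
    by apply: ler_wpM2l => //; apply: divr_ge0 => //; exact: ltW.
  by rewrite divfK ?gt_eqF//; lra.
rewrite -natrX.
(* Nonnegativity lets the coefficient 1 of this logarithm grow to 2 (1 + r). *)
have D : 0 <= ln delta^-1 by apply: ln_ge0; rewrite invf_ge1// ltW.
have r0 : 0 <= ln (a%:R : R) / ln 2 by apply: divr_ge0 => //; exact: ltW.
set r := ln a%:R / ln 2 in lnQ r0 *.
rewrite [_ * S%:R]mulrC -[leRHS]mulrA; apply: ler_wpM2l => //.
have T := ler_wpM2l (ler0n R (3 ^ L)) lnQ.
have T2 := mulr_ge0 r0 D.
nra.
Qed.
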